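(* Let $1\le k<m<\omega$, $n=\binom mk$, and let $\vec S=\langle S_0,\dots,S_{n-1}\rangle$ be an $n$-tuple listing all $k$-element subsets of $m$. Let $X_0,\dots,X_{m-1}$ be nonempty sets and let $\mathcal A$ be the $\vec S$-cube for $A=X_0\times X_1\times\dots\times X_{m-1}$. Then $\mathcal A$ has an acceptable coloring if and only if there is $d<m-k+1$ such that $|\{j<m:|X_j|<\aleph_d\}|\ge d+k$.
   Context: An $n$-indexed hyperspace is $(A;E_0,\dots,E_{n-1})$ with each $E_i$ an equivalence relation on $A$; $[a]_i$ is the $E_i$-class of $a$. The $\vec S$-cube for $A=X_0\times\dots\times X_{m-1}$ is $(A;E_0,\dots,E_{n-1})$ where $\langle x,y\rangle\in E_i$ iff $x_j=y_j$ for every $j\in m\setminus S_i$. A coloring is $\chi:A\to n$; it is acceptable if for every $a\in A$ and $i<n$ the set $\{x\in[a]_i:\chi(x)=i\}$ is finite. *)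

(* Defs.v *)
From Stdlib Require Import RelationClasses.
From mathcomp Require Import all_boot.
From mathcomp Require Import boolp classical_sets cardinality.

Set Implicit Arguments.
Unset Strict Implicit.
Unset Printing Implicit Defensive.

Local Open Scope classical_set_scope.
Local Open Scope card_scope.

Record hyperspace (n : nat) := Hyperspace {
  carrier :> Type;
  hrel : 'I_n -> carrier -> carrier -> Prop;
  hrel_equiv : forall i, Equivalence (hrel i)
}.

Definition hclass (n : nat) (H : hyperspace n) (i : 'I_n) (a : H) : set H :=
  [set x | hrel i a x].

Definition acceptable (n : nat) (H : hyperspace n) (chi : H -> 'I_n) : Prop :=
  forall (a : H) (i : 'I_n), finite_set [set x | hclass i a x /\ chi x = i].

Definition cube_rel (m n : nat) (S : n.-tuple {set 'I_m}) (X : 'I_m -> Type)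
    (i : 'I_n) (x y : forall j, X j) : Prop :=
  forall j, j \notin tnth S i -> x j = y j.

Lemma cube_rel_equiv (m n : nat) (S : n.-tuple {set 'I_m}) (X : 'I_m -> Type)
  (i : 'I_n) : Equivalence (@cube_rel m n S X i).
Proof.
split=> [x j _ //|x y xy j jS|x y z xy yz j jS]; first by rewrite xy.
by rewrite xy // yz.
Qed.

Definition cube (m n : nat) (S : n.-tuple {set 'I_m}) (X : 'I_m -> Type) :
    hyperspace n :=
  Hyperspace (@cube_rel_equiv m n S X).

Definition card_lt (T U : Type) : Prop :=
  [set: T] #<= [set: U] /\ ~ ([set: U] #<= [set: T]).

Definition succ_card (T U : Type) : Prop :=
  card_lt T U /\ forall V : Type, card_lt T V -> [set: U] #<= [set: V].

(* There is no type of cardinals: [is_aleph d T] says that |T| = aleph_d. *)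
Fixpoint is_aleph (d : nat) (T : Type) : Prop :=
  if d is d'.+1 then exists U : Type, is_aleph d' U /\ succ_card U T
  else [set: T] #= [set: nat].

Definition card_lt_aleph (T : Type) (d : nat) : Prop :=
  exists U : Type, is_aleph d U /\ card_lt T U.

(* Main.v *)
(** For k = 1 this is the Kuratowski-Sierpinski theorem, and the general case
    follows its proof.

    If d + k of the factors have fewer than aleph_d elements, embed these into
    one well-ordered set whose proper initial segments have fewer than
    aleph_(d-1) elements.  Once the largest of the d + k coordinates is fixed,
    the others live in such a segment, and induction on d colors them.

    Otherwise there are distinct coordinates s_0, ..., s_(m-k) with at least
    aleph_d elements in the factor s_d.  Every k-element set of coordinates
    contains some s_d, so an acceptable coloring yields a coloring by the s_d
    with finitely many points of color s_d on each line in direction s_d.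
    Shrinking the factors to size exactly aleph_d, one fixes the coordinates
    s_(m-k), ..., s_0 in turn so that each of these colors is avoided. *)

From Stdlib Require Import Inverse_Image.
Require Import Defs.
From mathcomp Require Import all_boot zify.
From mathcomp Require Import boolp classical_sets functions cardinality wochoice.

Set Implicit Arguments.
Unset Strict Implicit.
Unset Printing Implicit Defensive.

Local Open Scope classical_set_scope.
Local Open Scope card_scope.

(** * Well-orders *)

Definition strict_wo (T : Type) (R : T -> T -> Prop) : Prop :=
  well_founded R /\ forall x y, [\/ R x y, x = y | R y x].

(** The endpoint [x] is included, so coordinates tied for the largest still lie in the segment, and
    it is never empty. *)
Definition seg (T : Type) (R : T -> T -> Prop) (x : T) : Type :=
  {y : T | R y x \/ y = x}.

Lemma sval_injective (T : Type) (P : T -> Prop) : injective (@sval T P).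
Proof. by move=> [x px] [y py] /= xy; apply: eq_exist. Qed.

Lemma strict_wo_min (T : Type) (R : T -> T -> Prop) (P : T -> Prop) :
  strict_wo R -> (exists x, P x) -> exists2 x, P x & forall y, R y x -> ~ P y.
Proof.
move=> [wfR _] [x Px]; apply: contrapT => noMin.
elim/(well_founded_ind wfR): x Px => x IH Px.
by apply: noMin; exists x.
Qed.

(** By trichotomy a failure means [z = x] or [R z x]; either closes a cycle, leaving the points [x],
    [y], [z] without a minimal one. *)
Lemma strict_wo_trans (T : Type) (R : T -> T -> Prop) x y z :
  strict_wo R -> R x y -> R y z -> R x z.
Proof.
move=> woR Rxy Ryz; case: (woR.2 x z) => // zx; exfalso;
have [|t Pt tmin] := @strict_wo_min _ R
  (fun t => [\/ t = x, t = y | t = z]) woR.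
- by exists x; constructor 1.
- case: Pt => tE; subst t.
  + by apply: (tmin y); [rewrite zx|constructor 2].
  + by apply: (tmin x); [|constructor 1].
  + by apply: (tmin y); [|constructor 2].
- by exists x; constructor 1.
- case: Pt => tE; subst t.
  + by apply: (tmin z); [|constructor 3].
  + by apply: (tmin x); [|constructor 1].
  + by apply: (tmin y); [|constructor 2].
Qed.

Lemma strict_wo_inj (T U : Type) (R : U -> U -> Prop) (f : T -> U) :
  injective f -> strict_wo R -> strict_wo (fun x y => R (f x) (f y)).
Proof.
move=> finj [wfR triR]; split; first exact: wf_inverse_image.
move=> x y; case: (triR (f x) (f y)) => [|/finj|];
  by [constructor 1|constructor 2|constructor 3].
Qed.

Lemma strict_wo_exists (T : Type) : exists R : T -> T -> Prop, strict_wo R.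
Proof.
elim/Peq: T => T; have [W woW] := well_ordering_principle T.
have minW (A : set T) : A !=set0 -> exists2 z, A z & forall x, A x -> W z x.
  move=> [x Ax]; have [|z [[zA lbz] _]] := woW [pred x | `[< A x >]].
    by exists x; apply/asboolP.
  exists z => [|y Ay]; first exact/asboolP.
  by apply: lbz; apply/asboolP.
(* The pair of [x] and [y] has a unique least element, and here both are least. *)
have antiW x y : W x y -> W y x -> x = y.
  move=> Wxy Wyx; have [|z [_ zu]] := woW (pred2 x y).
    by exists x; rewrite !inE eqxx.
  have Wxx : W x x.
    by have [|t -> ] := minW [set x]; [exists x|apply].
  have Wyy : W y y.
    by have [|t -> ] := minW [set y]; [exists y|apply].
  rewrite -(zu x) ?(zu y) //; split; rewrite ?inE ?eqxx ?orbT // => t;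
  by rewrite !inE => /orP[] /eqP ->.
exists (fun x y => ~ W y x); split.
  move=> x; apply: contrapT => nAcc.
  have [|z nz zmin] := minW [set x | ~ Acc (fun x y => ~ W y x) x].
    by exists x.
  by apply: nz; constructor => y nWzy; apply: contrapT => /zmin.
move=> x y; have [Wxy|nWxy] := pselect (W x y); last by constructor 3.
have [Wyx|nWyx] := pselect (W y x); last by constructor 1.
by constructor 2; apply: antiW.
Qed.

(** * The hierarchy of cardinals below aleph_omega *)

(* [small d T] means |T| < aleph_d: a set has fewer than aleph_(d+1) elements
   iff it has a well-order all of whose initial segments have fewer than
   aleph_d elements. *)
Fixpoint small (d : nat) (T : Type) : Prop :=
  if d is d'.+1 then
    exists2 R : T -> T -> Prop, strict_wo R & forall x, small d' (seg R x)
  else finite_set [set: T].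

Lemma card_leTT (T U : Type) :
  ([set: T] #<= [set: U]) <-> exists f : T -> U, injective f.
Proof.
split=> [/card_leP/injfunPex[f _ finj]|[f finj]].
  exists (fun x => val (f (SigSub (mem_set (I : setT x))))) => x y /val_inj fxy.
  by have [] := finj _ _ (in_setT _) (in_setT _) fxy.
have /injfunPex[g] :
    exists2 g, set_fun [set: T] [set: U] g & set_inj [set: T] g.
  by exists f => // x y _ _; apply: finj.
exact: inj_card_le.
Qed.

Lemma finite_set_finfib (T U : Type) (A : set T) (f : T -> U) :
  finite_set (f @` A) -> (forall u, finite_set (A `&` f @^-1` [set u])) ->
  finite_set A.
Proof.
move=> finB finf.
apply: (@sub_finite_set _ _ (\bigcup_(u in f @` A) (A `&` f @^-1` [set u]))).
  by move=> x Ax; exists (f x).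
exact: bigcup_finite.
Qed.

Lemma inj_finite_preimage (T U : Type) (f : T -> U) (B : set U) :
  injective f -> finite_set B -> finite_set (f @^-1` B).
Proof. by move=> finj; apply: finite_preimage => x y _ _; apply: finj. Qed.

(* The last hypothesis is [small_inj] at level [d], whose proof by induction
   on [d] goes through this lemma. *)
Lemma small_rank d (T U : Type) (R : U -> U -> Prop) (f : T -> U) :
  strict_wo R -> (forall u, small d {x : T | R (f x) u \/ f x = u}) ->
  (forall V W (g : V -> W), injective g -> small d W -> small d V) ->
  small d.+1 T.
Proof.
move=> woR smallf injS; have [W woW] := strict_wo_exists T.
(* Rank by [f] comes first, ties are broken by an arbitrary well-order; a segment then contains only
   points of rank at most that of its endpoint. *)
pose L x y := R (f x) (f y) \/ f x = f y /\ W x y.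
exists L; first split.
- move=> x; move E : (f x) => u.
  elim/(well_founded_ind woR.1): u x E => u IHu x.
  elim/(well_founded_ind woW.1): x => x IHx fxu; constructor => y.
  rewrite /L fxu; case=> [Ryx|[fyu Wyx]]; last exact: IHx.
  exact: IHu Ryx _ _.
- move=> x y; rewrite /L; case: (woR.2 (f x) (f y)) => [?|E|?].
  + by constructor 1; left.
  + case: (woW.2 x y) => ?;
    by [constructor 1; right|constructor 2|constructor 3; right].
  + by constructor 3; left.
move=> x; have LR (z : seg L x) : R (f (sval z)) (f x) \/ f (sval z) = f x.
  by case: z => y /= [[|[]]|->]; auto.
apply: (injS _ _ (fun z => exist _ (sval z) (LR z))) (smallf (f x)).
by move=> z z' [] /sval_injective.
Qed.

(** Induction on [d] with [f] as rank: the points of rank at most [u] map finite-to-one into the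
    segment of [u]. *)
Lemma small_finfib d (T U : Type) (f : T -> U) :
  (forall u, finite_set (f @^-1` [set u])) -> small d U -> small d T.
Proof.
elim: d T U f => [|d IHd] T U f finf /=.
  move=> finU; apply: (@finite_set_finfib _ _ _ f) => [|u].
    exact: sub_finite_set finU.
  by rewrite setTI.
move=> [R woR smallR]; apply: (@small_rank d T U R f) => //; last first.
  move=> V W g ginj; apply: (IHd _ _ g) => w.
  exact: inj_finite_preimage (finite_set1 _).
move=> u; pose g (z : {x : T | R (f x) u \/ f x = u}) : seg R u :=
  exist _ (f (sval z)) (svalP z).
apply: (IHd _ _ g) (smallR u) => v.
apply: (@sub_finite_set _ _ (sval @^-1` (f @^-1` [set sval v]))).
  by move=> z /= <-.
exact: inj_finite_preimage (@sval_injective _ _) _.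
Qed.

Lemma small_inj d (T U : Type) (f : T -> U) :
  injective f -> small d U -> small d T.
Proof.
move=> finj; apply: (@small_finfib _ _ _ f) => u.
exact: inj_finite_preimage (finite_set1 _).
Qed.

Lemma small_finite d (T : Type) : finite_set [set: T] -> small d T.
Proof.
elim: d T => [//|d IHd] T finT.
have [R woR] := strict_wo_exists T; exists R => // x; apply: IHd.
apply/(card_le_finite _ finT)/card_leTT.
by exists sval; apply: sval_injective.
Qed.

Lemma smallS d (T : Type) : small d T -> small d.+1 T.
Proof.
move=> smallT; have [R woR] := strict_wo_exists T; exists R => // x.
exact: (small_inj (@sval_injective _ _)) smallT.
Qed.

Lemma small_le d e (T : Type) : d <= e -> small d T -> small e T.
Proof.
move/subnK <-; elim: (e - d) => [//|c IHc] smallT.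
by rewrite addSn; apply/smallS/IHc.
Qed.

(* Greedy recursion along the well-order of [U]: the part of [T] already used
   up is small, so it is not all of [T]. *)
Lemma small_inj_large d (T U : Type) :
  small d.+1 U -> ~ small d T -> exists f : U -> T, injective f.
Proof.
move=> [R woR smallR] largeT.
have [t0 _] : exists t : T, True.
  apply: contrapT => Tempty; apply/largeT/small_finite.
  by rewrite (_ : setT = set0) // -subset0 => t; case: Tempty; exists t.
(* [t0] is a default for the case, refuted in [fR], that the earlier values exhaust [T]. *)
pose F u (rec : forall v, R v u -> T) : T :=
  if pselect (exists t, forall v (h : R v u), rec v h <> t) is left e
  then sval (cid e) else t0.
pose f := Fix woR.1 (fun=> T) F.
have fE u : f u = F u (fun v _ => f v).
  rewrite /f Fix_eq // => x g h gh.
  congr F; apply: functional_extensionality_dep => y.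
  exact: functional_extensionality_dep.
have fR u v : R v u -> f v <> f u.
  move=> Rvu; rewrite [f u]fE /F; case: pselect => [e|].
    by case: cid => /= t; apply.
  case; apply: contrapT => full; apply: largeT.
  have /choice[g gP] : forall t, exists v : seg R u, f (sval v) = t.
    move=> t; apply: contrapT => nv; apply: full; exists t => w Rwu fw.
    by apply: nv; exists (exist _ w (or_introl Rwu)).
  by apply: (small_inj (f := g)) (smallR u) => s t gst; rewrite -(gP s) gst.
by exists f => u v fuv; case: (woR.2 u v) => // /fR; rewrite fuv.
Qed.

(** * Sets of cardinality exactly aleph_d *)

Definition has_aleph (d : nat) (K : Type) : Prop := small d.+1 K /\ ~ small d K.

(** Either all segments of a well-order of [T] are small and [T] itself qualifies, or [T] is cut
    just below the first point with a large segment. *)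
Lemma large_sub_aleph d (T : Type) : ~ small d T ->
  exists A : set T, has_aleph d {x | A x}.
Proof.
move=> largeT; have [R woR] := strict_wo_exists T.
have [allsmall|] := pselect (forall x, small d (seg R x)).
  exists setT; split.
    by apply: (small_inj (@sval_injective _ _)); exists R.
  move=> sT; apply: largeT.
  by apply: (small_inj (f := fun x => exist setT x I)) sT => x y [].
move=> /existsNP large; have [x xlarge xmin] := strict_wo_min woR large.
exists (R^~ x); split.
  exists (fun y z => R (sval y) (sval z)).
    exact: strict_wo_inj (@sval_injective _ _) woR.
  move=> y; have /contrapT := xmin _ (svalP y).
  have yR (z : seg (fun y z : {t | R t x} => R (sval y) (sval z)) y) :
      R (sval (sval z)) (sval y) \/ sval (sval z) = sval y.
    by case: z => z /= [|->]; auto.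
  apply: (small_inj (f := fun z => exist _ (sval (sval z)) (yR z))).
  by move=> z z' [] /sval_injective/sval_injective.
move=> smallK; apply: xlarge.
have [[k0]|noK] := pselect (inhabited {y | R y x}); last first.
  apply: small_finite; apply: (@sub_finite_set _ _ (sval @^-1` [set x])).
    by move=> [y [Ryx|//]] _; case: noK; constructor; exists y.
  exact: inj_finite_preimage (@sval_injective _ _) (finite_set1 _).
(* Only the endpoint [x] needs a new value in the open segment, so fibres have at most two points
   and the closed segment would be small as well. *)
have /choice[g gP] : forall z : seg R x,
    exists k : {y | R y x}, sval z = x \/ sval k = sval z.
  by move=> [y [Ryx|yx]]; [exists (exist _ y Ryx); right|exists k0; left].
apply: (small_finfib (f := g)) smallK => k.
apply: (@sub_finite_set _ _ (sval @^-1` [set x; sval k])).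
  by move=> z /= <-; case: (gP z) => [->|<-]; [left|right].
exact: inj_finite_preimage (@sval_injective _ _) (finite_set2 _ _).
Qed.

(** By Cantor's diagonal argument the power set of a set of size aleph_d is not small at level
    [d.+1]; a subset of the right size is then cut out. *)
Lemma has_aleph_exists d : exists K : Type, has_aleph d K.
Proof.
suff [T /large_sub_aleph[A]] : exists T : Type, ~ small d T by exists {x | A x}.
elim: d => [|d [T /large_sub_aleph[A [smallA largeA]]]].
  by exists nat; apply: infinite_nat.
exists (set {x | A x}) => smallP.
have [f finj] := small_inj_large smallP largeA.
pose D := [set x | exists2 B, f B = x & ~ B x].
have [Df|nDf] := pselect (D (f D)); last first.
  by apply: (nDf); exact: (ex_intro2 _ _ D).
by have [B /finj BD] := Df; rewrite BD.
Qed.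

Lemma is_alephE d (K : Type) : is_aleph d K <-> has_aleph d K.
Proof.
elim: d K => [|d IHd] K /=.
  rewrite card_eq_le; split=> [/andP[Kn nK]|[smallK largeK]].
    split; last by move=> finK; apply: infinite_nat; apply: card_le_finite finK.
    move/card_leTT: Kn => [f finj]; apply: (small_inj finj).
    exists (fun x y => is_true (x < y)) => [|x].
      split=> [y|y z]; first by elim/ltn_ind: y; constructor.
      by case: (ltngtP y z) => ?; [constructor 1|constructor 3|constructor 2].
    apply: (@sub_finite_set _ _ (sval @^-1` `I_x.+1)).
      by move=> [y [yx|yx]] _ /=; [exact: leqW yx|rewrite yx].
    exact: inj_finite_preimage (@sval_injective _ _) (finite_II _).
  apply/andP; split; last exact/infiniteP.
  by apply/card_leTT; apply: small_inj_large smallK _; apply: infinite_nat.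
split=> [[U [/IHd[smallU largeU] [[UK nKU] Kmin]]]|[smallK largeK]].
  have largeK : ~ small d.+1 K.
    by move=> smallK; apply/nKU/card_leTT/(small_inj_large smallK).
  (* Any [V] of size aleph_(d+1) lies strictly above [U], so the minimality of [K] embeds [K] into
     [V]. *)
  split=> //; have [V [smallV largeV]] := has_aleph_exists d.+1.
  have /card_leTT[f finj] : [set: K] #<= [set: V];
    last exact: small_inj finj smallV.
  apply: Kmin; split; first exact/card_leTT/(small_inj_large (smallS smallU)).
  by move=> /card_leTT[f finj]; apply: largeV; exact: small_inj finj smallU.
have [U kU] := has_aleph_exists d; exists U; split; first exact/IHd.
have [smallU largeU] := kU.
split=> [|V [UV nVU]].
  split; first exact/card_leTT/(small_inj_large (smallS smallU)).
  by move=> /card_leTT[f finj]; apply: largeK; exact: small_inj finj smallU.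
apply/card_leTT/(small_inj_large smallK) => smallV.
by apply/nVU/card_leTT/(small_inj_large smallV).
Qed.

Lemma card_lt_alephE (T : Type) d : card_lt_aleph T d <-> small d T.
Proof.
split=> [[U [/is_alephE[smallU largeU] [TU nUT]]]|smallT].
  apply: contrapT => largeT.
  by apply/nUT/card_leTT/(small_inj_large smallU).
have [U [smallU largeU]] := has_aleph_exists d.
exists U; split; first exact/is_alephE.
split; first exact/card_leTT/(small_inj_large (smallS smallT)).
by move=> /card_leTT[f finj]; apply: largeU; exact: small_inj finj smallT.
Qed.

(** * Maxima and finite powers of small sets *)

Lemma strict_wo_argmax (I : eqType) (T : Type) (R : T -> T -> Prop) (x : I -> T)
    (s : seq I) : strict_wo R -> s != [::] ->
  exists2 i, i \in s & forall j, j \in s -> R (x j) (x i) \/ x j = x i.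
Proof.
move=> woR; elim: s => [//|a s IHs] _.
have [->|/IHs[i si imax]] := eqVneq s [::].
  by exists a; rewrite ?inE// => j; rewrite inE => /eqP->; right.
have [lt_ai|ge_ai] := pselect (R (x i) (x a)); [exists a|exists i] => [|j||j].
- exact: mem_head.
- rewrite inE => /orP[/eqP->|/imax[ji|->]]; [by right| |by left].
  by left; apply: strict_wo_trans lt_ai.
- by rewrite inE si orbT.
- rewrite inE => /orP[/eqP->|/imax//].
  by case: (woR.2 (x a) (x i)) => ?; [left|right|].
Qed.

Lemma finite_inj_ord (T : Type) : finite_set [set: T] ->
  exists n, exists f : T -> 'I_n, injective f.
Proof.
move=> /finite_set_leP[n]; rewrite /= => /card_leP/injfunPex[f _ finj].
exists n; pose g x := val (f (SigSub (mem_set (I : setT x)))).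
have gn x : g x < n.
  by have /set_mem := svalP (f (SigSub (mem_set (I : setT x)))).
exists (fun x => Ordinal (gn x)) => x y [] /val_inj fxy.
by have [] := finj _ _ (in_setT _) (in_setT _) fxy.
Qed.

(** A tuple is ranked by a bound on its coordinates; tuples of rank at most [t] are tuples over the
    segment of [t], where induction applies. *)
Lemma small_pow d (I : finType) (T : Type) : small d T -> small d (I -> T).
Proof.
elim: d T => [|d IHd] T.
  move=> /finite_inj_ord[n [f finj]].
  apply: (small_inj (d := 0) (f := fun x : I -> T => [ffun i => f (x i)])).
    move=> x y /ffunP xy; apply/funext => i.
    by apply: finj; have := xy i; rewrite !ffunE.
  exact: finite_finset.
move=> [R woR smallR].
have [I0|In0] := eqVneq (enum I) [::].
  apply: small_finite.
  have xy (x y : I -> T) : x = y.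
    by apply/funext => i; have := mem_enum I i; rewrite I0.
  have [[x]|nx] := pselect (inhabited (I -> T)).
    by rewrite (_ : setT = [set x]) //; apply/seteqP; split=> // y _; apply: xy.
  by rewrite (_ : setT = set0) // -subset0 => y; case: nx.
have /choice[M MP] : forall x : I -> T, exists t,
    forall j, R (x j) t \/ x j = t.
  move=> x; have [i _ imax] := strict_wo_argmax x woR In0.
  by exists (x i) => j; apply: imax; rewrite mem_enum.
apply: (@small_rank d (I -> T) T R M) => // [t|V W g]; last exact: small_inj.
have le_t (x : {x | R (M x) t \/ M x = t}) i : R (sval x i) t \/ sval x i = t.
  case: x => x /= Mx; case: (MP x i) => [ltM|->] //; left.
  by case: Mx => [Mt|<-] //; apply: strict_wo_trans Mt.
apply: (small_inj (f := fun x i => exist _ (sval x i) (le_t x i)))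
  (IHd _ (smallR t)).
move=> x y xy; apply: sval_injective; apply/funext => i.
by have /(congr1 (fun z => sval (z i))) := xy.
Qed.

(** * Constructing colorings *)

Lemma dchoice (X : Type) (Y : X -> Type) (P : forall x, Y x -> Prop) :
  (forall x, exists y, P x y) -> exists f : forall x, Y x, forall x, P x (f x).
Proof.
by move=> /(_ _)/cid YP; exists (fun x => sval (YP x)) => x; apply: svalP.
Qed.

(** For [B = tnth S i] this is [cube_rel]. Naming the coordinate set itself lets colors be sets of
    coordinates. *)
Definition agree_off (I : finType) (X : I -> Type) (B : {set I})
    (x y : forall i, X i) : Prop := forall i, i \notin B -> x i = y i.

(* On points whose largest coordinate among those in [J] is the [j]-th, the
   other coordinates in [J] range over an initial segment, which is smaller
   than [T]; color by the inductive coloring of that segment, using subsets of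
   [J :\ j]. *)
Lemma power_coloring d k (I : finType) (J : {set I}) (T : Type) :
  small d T -> #|J| = d + k ->
  exists2 chi : (I -> T) -> {set I},
    forall x, chi x \subset J /\ #|chi x| = k &
    forall a B, finite_set [set x | agree_off B a x /\ chi x = B].
Proof.
elim: d J T => [|d IHd] J T smallT cardJ.
  exists (fun=> J) => // a B.
  exact: sub_finite_set (small_pow I smallT).
have [R woR smallR] := smallT.
have Jn0 : enum J != [::].
  by rewrite -size_eq0 -cardE cardJ.
have /choice[jm jmP] : forall x : I -> T, exists j, j \in J /\
    forall i, i \in J -> R (x i) (x j) \/ x i = x j.
  move=> x; have [j] := strict_wo_argmax x woR Jn0.
  rewrite mem_enum => jJ jmax; exists j; split=> // i iJ.
  by apply: jmax; rewrite mem_enum.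
have /dchoice[c cP] (p : I * T) : exists chi : (I -> seg R p.2) -> {set I},
    p.1 \in J ->
    (forall x, chi x \subset J :\ p.1 /\ #|chi x| = k) /\
    forall a B, finite_set [set x | agree_off B a x /\ chi x = B].
  have [pJ|pJ] := boolP (p.1 \in J); last by exists (fun=> finset.set0).
  have [|chi chi1 chi2] := IHd (J :\ p.1) _ (smallR p.2); last by exists chi.
  by move: cardJ; rewrite (cardsD1 p.1) pJ addSn add1n => -[].
(* Coordinates outside [J] may exceed the bound; they get an arbitrary value in the segment. *)
have /dchoice[retr retrP] (p : T * T) : exists y : seg R p.1,
    R p.2 p.1 \/ p.2 = p.1 -> sval y = p.2.
  have [le21|] := pselect (R p.2 p.1 \/ p.2 = p.1).
    by exists (exist (fun y => R y p.1 \/ y = p.1) _ le21).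
  by exists (exist (fun y => R y p.1 \/ y = p.1) _ (or_intror erefl)).
pose rt t (x : I -> T) (i : I) : seg R t := retr (t, x i).
pose chi x := c (jm x, x (jm x)) (rt (x (jm x)) x).
have chiP x : chi x \subset J :\ jm x /\ #|chi x| = k.
  have [jJ _] := jmP x; have [cJ _] := cP (jm x, x (jm x)) jJ; apply: cJ.
exists chi => [x|a B].
  have [sJ ck] := chiP x; split=> //.
  exact: fintype.subset_trans sJ (finset.subsetDl _ _).
(* The color [B] omits the position [j] of the largest coordinate, so that coordinate equals [a j]
   and the segment depends on [j] alone. *)
pose P j := [set x | j \in J /\ agree_off B a x /\
                     (forall i, i \in J -> R (x i) (a j) \/ x i = a j) /\
                     B \subset J /\ c (j, a j) (rt (a j) x) = B].
apply: (@sub_finite_set _ _ (\bigcup_(j in [set: I]) P j)).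
  move=> x [ax chix]; exists (jm x) => //.
  have [sJ _] := chiP x; have [jJ jmax] := jmP x.
  have axj : a (jm x) = x (jm x).
    apply: ax; rewrite -chix.
    by apply/negP => /(fintype.subsetP sJ); rewrite !inE eqxx.
  rewrite /P /= axj; do !split => //.
  by rewrite -chix; apply: fintype.subset_trans sJ (finset.subsetDl _ _).
apply: bigcup_finite => [|j _]; first exact: finite_finset.
have [jJ|jJ] := boolP (j \in J); last first.
  by rewrite (_ : P j = set0) // -subset0 => x []; rewrite (negPf jJ).
have [_ /(_ (rt (a j) a) B) finj] := cP (j, a j) jJ.
apply: (@finite_set_finfib _ _ _ (rt (a j))).
  apply: sub_finite_set finj => _ [x [_ [ax [_ [_ cx]]]] <-]; split=> //.
  by move=> i iB; rewrite /rt (ax i iB).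
(* On [P j] the map [rt (a j)] is injective: coordinates in [B] are at most [a j] and hence kept,
   the others agree with [a]. *)
move=> u; have [[x0 [[_ [ax0 [ler0 [BJ _]]]] rx0]]|no] :=
  pselect (P j `&` rt (a j) @^-1` [set u] !=set0); last first.
  rewrite (_ : _ `&` _ = set0) //; apply: contrapT => /eqP/set0P; exact: no.
apply: sub_finite_set (finite_set1 x0) => x [[_ [ax [ler _]]] rx] /=.
apply/funext => i; have [iB|/[dup] /ax <- /ax0 //] := boolP (i \in B).
have iJ := fintype.subsetP BJ _ iB.
have rE y : R (y i) (a j) \/ y i = a j -> sval (rt (a j) y i) = y i.
  by move=> /(retrP (a j, y i)).
by rewrite -(rE x (ler i iJ)) -(rE x0 (ler0 i iJ)) rx rx0.
Qed.

Lemma small_common (I : finType) (J : {set I}) (X : I -> Type) d :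
  (forall j, j \in J -> small d (X j)) ->
  exists2 T, small d T & forall j, j \in J -> exists f : X j -> T, injective f.
Proof.
case: d => [|d] smallX.
  have /choice[n nP] (j : I) :
      exists n, j \in J -> exists f : X j -> 'I_n, injective f.
    have [jJ|jJ] := boolP (j \in J); last by exists 0.
    by have [n] := finite_inj_ord (smallX j jJ); exists n.
  exists 'I_(\max_j n j); first exact: finite_finset.
  move=> j /nP[f finj]; exists (widen_ord (leq_bigmax j) \o f).
  by apply: inj_comp finj => x y /(congr1 val) /= /val_inj.
have [K [smallK largeK]] := has_aleph_exists d; exists K => // j jJ.
exact: small_inj_large (smallX j jJ) largeK.
Qed.

Lemma subset_card_exists (I : finType) (A : {set I}) p :
  p <= #|A| -> exists2 J : {set I}, J \subset A & #|J| = p.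
Proof.
move=> pA; exists [set:: take p (enum A)].
  by apply/fintype.subsetP => i; rewrite inE => /mem_take; rewrite mem_enum.
rewrite cardsE (card_uniqP _) ?take_uniq ?enum_uniq //.
by rewrite size_takel // -cardE.
Qed.

(** The power coloring is pulled back along a product of maps that are injective on [J]. Colors are
    subsets of [J], so the product is injective on each class that matters. *)
Lemma box_coloring d k (I : finType) (X : I -> Type) (A : {set I}) :
  0 < k -> (forall i, inhabited (X i)) ->
  (forall j, j \in A -> small d (X j)) -> d + k <= #|A| ->
  exists2 chi : (forall i, X i) -> {set I},
    forall x, #|chi x| = k &
    forall a B, finite_set [set x | agree_off B a x /\ chi x = B].
Proof.
move=> k0 inhX smallX /subset_card_exists[J sJA cardJ].
have {}smallX j : j \in J -> small d (X j) by move/(fintype.subsetP sJA)/smallX.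
have [T smallT injT] := small_common smallX.
(* Since [0 < k], [J] is nonempty; [t0] serves as the constant value on coordinates outside [J]. *)
have [t0] : inhabited T.
  have [j jJ] : exists j, j \in J.
    by apply/card_gt0P; rewrite cardJ addn_gt0 k0 orbT.
  by have [f _] := injT j jJ; have [x] := inhX j; constructor; exact: f x.
have /dchoice[f fP] : forall i, exists f : X i -> T, i \in J -> injective f.
  move=> i; have [/injT[f finj]|_] := boolP (i \in J); first by exists f.
  by exists (fun=> t0).
have [chi chiP fin] := power_coloring smallT cardJ.
pose F (x : forall i, X i) i := f i (x i).
exists (chi \o F) => [x|a B]; first by have [] := chiP (F x).
have [BJ|BJ] := boolP (B \subset J); last first.
  rewrite (_ : mkset _ = set0) // -subset0 => x [_ xB].
  by have [] := chiP (F x); rewrite -xB /= in BJ; rewrite (negPf BJ).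
apply: (@finite_set_finfib _ _ _ F).
  apply: sub_finite_set (fin (F a) B) => _ [x [ax xB] <-]; split=> //.
  by move=> i iB; rewrite /F ax.
move=> u; have [[x0 [[ax0 _] Fx0]]|no] :=
  pselect ([set x | agree_off B a x /\ (chi \o F) x = B] `&` F @^-1` [set u]
           !=set0); last first.
  rewrite (_ : _ `&` _ = set0) //; apply: contrapT => /eqP/set0P; exact: no.
apply: sub_finite_set (finite_set1 x0) => x [[ax _] Fx] /=.
apply: functional_extensionality_dep => i.
have [iB|/[dup] /ax <- /ax0 //] := boolP (i \in B).
apply: (fP i (fintype.subsetP BJ _ iB)); rewrite -/(F x i) -/(F x0 i).
by rewrite Fx Fx0.
Qed.

(** * Nonexistence of colorings *)

(** Greedy choice from the top: once [s r] is removed from [J], each count drops by at most one, and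
    so does each bound [r - d]. *)
Lemma large_transversal r (I : finType) (X : I -> Type) (J : {set I}) :
  (forall d, d <= r -> r - d < #|[set j in J | `[< ~ small d (X j) >]]|) ->
  exists s : nat -> I,
    (forall d, d <= r -> s d \in J /\ ~ small d (X (s d))) /\
    {in [pred d | d <= r] &, injective s}.
Proof.
elim: r J => [|r IHr] J large.
  have /card_gt0P[j] := large 0 isT; rewrite inE => /andP[jJ /asboolP jl].
  exists (fun=> j); split=> [d|d e]; first by rewrite leqn0 => /eqP->.
  by rewrite !inE !leqn0 => /eqP-> /eqP->.
have := large r.+1 (leqnn _); rewrite subnn => /card_gt0P[j].
rewrite inE => /andP[jJ /asboolP jl].
have [d dr|s [sP sinj]] := IHr (J :\ j).
  have := large d (leqW dr); rewrite (cardsD1 j) subSn //.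
  move=> /leq_trans-/(_ _ (leq_add (leq_b1 _) (leqnn _))).
  rewrite add1n ltnS => /leq_trans; apply.
  apply/subset_leq_card/fintype.subsetP => i.
  by rewrite !inE => /and3P[-> -> ->].
have sj d : d <= r -> s d != j by move=> /sP[]; rewrite !inE => /andP[].
exists (fun d => if d <= r then s d else j); split=> [d|d e].
  case: (leqP d r) => [dr _|rd dr]; last first.
    by have -> : d = r.+1 by apply/eqP; rewrite eqn_leq dr.
  by have [+ ?] := sP d dr; rewrite inE => /andP[].
rewrite !inE => dr er; case: (leqP d r) => [dr'|rd];
  case: (leqP e r) => [er'|re].
- exact: sinj.
- by move=> sdj; have := sj d dr'; rewrite sdj eqxx.
- by move=> sej; have := sj e er'; rewrite -sej eqxx.
- by move=> _; apply/eqP; rewrite eqn_leq (leq_trans dr) // (leq_trans er).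
Qed.

(* Fix the coordinates [s q] for q = r, ..., 0: as the box spanned by the
   coordinates [s d], d < q, has fewer than aleph_q points, some value of the
   coordinate [s q] avoids, for all points of the box simultaneously, the
   finitely many values that are colored [s q]. *)
Lemma line_coloring_absurd r (I : finType) (X : I -> Type) (s : nat -> I)
    (c : (forall i, X i) -> I) (a : forall i, X i) :
  {in [pred d | d <= r] &, injective s} ->
  (forall d, d <= r -> ~ small d (X (s d))) ->
  (forall x, exists2 d, d <= r & c x = s d) ->
  (forall b i, finite_set [set x | agree_off [set i] b x /\ c x = i]) ->
  False.
Proof.
move=> sinj large cs fin.
have /dchoice[A AP] d :
    exists A : set (X (s d)), d <= r -> has_aleph d {x | A x}.
  have [/large/large_sub_aleph[A kA]|_] := boolP (d <= r); first by exists A.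
  by exists setT.
pose box q b x := agree_off [set s (val d) | d : 'I_q] b x /\
                  forall d, d < q -> A d (x (s d)).
(* [p] counts the coordinates already fixed. At [p = r.+1] the box is the single point [b], which
   has no color left. *)
suff box_avoid p : p <= r.+1 -> exists b,
    forall x, box (r.+1 - p) b x ->
    forall d, r.+1 - p <= d <= r -> c x <> s d.
  have [b bP] := box_avoid r.+1 (leqnn _); have [d dr cd] := cs b.
  by apply: (bP b _ d _ cd); rewrite subnn //; split.
elim: p => [|p IHp] pr.
  exists a => x _ d; rewrite subn0 => /andP[rd dr].
  by have := leq_trans rd dr; rewrite ltnn.
have [b bP] := IHp (ltnW pr); rewrite subSS; set q := r - p.
have qr : q <= r by apply: leq_subr.
rewrite subSn // -/q in bP.
pose Y := {y | box q b y}.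
(* For [q > 0] the box embeds into the [q]-th power of a set of size aleph_(q-1); for [q = 0] it has
   at most one point. *)
have smallY : small q Y.
  have YA (y : Y) (d : 'I_q) : A d (sval y (s d)).
    by case: (svalP y) => _; apply.
  have [q0|q1] := posnP q.
    apply: small_finite; have [[y0]|noY] := pselect (inhabited Y); last first.
      by rewrite (_ : setT = set0) // -subset0 => y; case: noY.
    apply: sub_finite_set (finite_set1 y0) => y _; apply: sval_injective.
    apply: functional_extensionality_dep => i.
    have iq : i \notin [set s (val d) | d : 'I_q].
      by apply/imsetP => -[d]; have := ltn_ord d; rewrite {2}q0.
    by case: (svalP y) (svalP y0) => by1 _ [by2 _]; rewrite -by1 // -by2.
  have [K [smallK largeK]] := has_aleph_exists q.-1.
  rewrite prednK // in smallK.
  have /dchoice[h hinj] (d : 'I_q) : exists h : {x | A d x} -> K, injective h.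
    apply: small_inj_large largeK; rewrite prednK //.
    have [smallA _] := AP d (leq_trans (ltnW (ltn_ord d)) qr).
    exact: small_le smallA.
  pose g (y : Y) (d : 'I_q) := h d (exist _ (sval y (s d)) (YA y d)).
  apply: (small_inj (f := g)) (small_pow _ smallK) => y z gyz.
  apply: sval_injective; apply: functional_extensionality_dep => i.
  have [/imsetP[d _ ->]|iq] := boolP (i \in [set s (val d) | d : 'I_q]).
    by have /hinj[] : g y d = g z d by rewrite gyz.
  by case: (svalP y) (svalP z) => by1 _ [by2 _]; rewrite -by1 // -by2.
have [[t At tP]|no] := pselect (exists2 t, A q t &
    forall y, box q b y -> c (dfwith y t) <> s q).
  exists (dfwith b t) => x [bx Ax] d /andP[qd dr].
  have xsq : x (s q) = t.
    rewrite -bx ?dfwith_in //; apply/imsetP => -[e _ /sinj].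
    rewrite !inE qr (leq_trans (ltnW (ltn_ord e)) qr) => /(_ isT isT) qe.
    by have := ltn_ord e; rewrite -qe ltnn.
  have [qd'|qd'] := eqVneq q d.
    (* Resetting coordinate [s q] to its value in [b] gives a point of [box q b]; putting [t] back
       recovers [x]. *)
    rewrite -qd'; have -> : x = dfwith (dfwith x (b (s q))) t.
      apply: functional_extensionality_dep => i.
      by case: dfwithP => [//|j sj]; rewrite dfwith_out.
    apply: tP; split=> [i iq|e eq].
      by case: dfwithP iq => [//|j sj] iq; rewrite -bx // dfwith_out.
    rewrite dfwith_out; first exact: Ax.
    apply/eqP => /sinj; rewrite !inE qr (leq_trans (ltnW eq) qr).
    by move=> /(_ isT isT) qe; rewrite qe ltnn in eq.
  apply: bP; last by rewrite dr andbT ltn_neqAle qd' qd.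
  split=> [i iq|e].
    rewrite -bx.
      rewrite dfwith_out //; apply: contra iq => /eqP <-.
      by apply/imsetP; exists ord_max.
    apply: contra iq => /imsetP[e _ ->]; apply/imsetP.
    by exists (widen_ord (leqnSn _) e).
  by rewrite ltnS leq_eqVlt => /orP[/eqP->|/Ax//]; rewrite xsq.
case: (AP q qr) => _; case.
(* If every [t] fails, it fails at some box point [g t]. Each line has finitely many points of color
   [s q], so [g] is finite-to-one and [A q] would be small. *)
have /choice[g gP] (t : {x | A q x}) :
    exists y : Y, c (dfwith (sval y) (sval t)) = s q.
  apply: contrapT => ny; apply: no; exists (sval t); first exact: svalP.
  by move=> y yB cy; apply: ny; exists (exist _ y yB).
apply: (small_finfib (f := g)) smallY => y.
pose w (t : {x | A q x}) := dfwith (sval y) (sval t).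
have winj : injective w.
  move=> t t' /(congr1 (fun x => x (s q))); rewrite /w !dfwith_in.
  exact: sval_injective.
apply: sub_finite_set (inj_finite_preimage winj (fin (sval y) (s q))).
move=> t /= gt.
split; last by rewrite /= /w -gt gP.
by move=> i; rewrite inE eq_sym => ?; rewrite /w dfwith_out.
Qed.

(** * Acceptable colorings of cubes *)

Theorem theorem3p9 (m k n : nat) (hk : 1 <= k) (hkm : k < m)
    (hn : n = 'C(m, k))
    (S : n.-tuple {set 'I_m})
    (hS : forall B : {set 'I_m}, (B \in S) = (#|B| == k))
    (X : 'I_m -> Type) (hX : forall j, inhabited (X j)) :
  (exists chi : cube S X -> 'I_n, acceptable chi) <->
  (exists d : nat, d < m - k + 1 /\
     d + k <= #|[pred j : 'I_m | `[< card_lt_aleph (X j) d >]]|).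
Proof.
have cardS i : #|tnth S i| = k by apply/eqP; rewrite -hS mem_tnth.
have cardE d : #|[pred j : 'I_m | `[< card_lt_aleph (X j) d >]]| =
               #|[set j : 'I_m | `[< small d (X j) >]]%SET|.
  rewrite cardsE; apply: eq_card => j; rewrite !inE.
  by apply: asbool_equiv_eq; apply: card_lt_alephE.
split=> [[chi acc]|[d [dmk]]]; last first.
  rewrite cardE => /(box_coloring hk hX)[j|col colk fin].
    by rewrite inE => /asboolP.
  have /choice[chi chiP] (x : cube S X) : exists i, tnth S i = col x.
    have : col x \in S by rewrite hS colk.
    by move=> /tnthP[i ->]; exists i.
  exists chi => a i; apply: sub_finite_set (fin a (tnth S i)) => x [ax xi].
  by split=> //; rewrite -chiP xi.
apply: contrapT => no.
have [|s [sP sinj]] := @large_transversal (m - k) 'I_m X [set: 'I_m]%SET.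
  (* If at most [m - k - d] factors are large at level [d], then at least [d + k] are small,
     contrary to [no]. *)
  move=> d dmk; rewrite ltnNge; apply/negP => few; apply: no.
  exists d; rewrite addn1 ltnS; split=> //; rewrite cardE.
  have := cardsC [set j : 'I_m | `[< small d (X j) >]]%SET; rewrite card_ord.
  have : #|~: [set j : 'I_m | `[< small d (X j) >]]%SET| <= m - k - d.
    apply: leq_trans few; apply/eq_leq/eq_card => j.
    by rewrite !inE asbool_neg.
  by lia.
have /choice[c cP] (x : cube S X) :
    exists i, i \in tnth S (chi x) /\ exists2 d, d <= m - k & i = s d.
  (* [D] has [m - k + 1] elements and a listed set has [k], together more than [m], so they meet. *)
  pose D := [set s (val d) | d : 'I_(m - k).+1].
  have /set0Pn[i] : tnth S (chi x) :&: D != finset.set0.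
    rewrite -cards_eq0.
    have : #|D| = (m - k).+1.
      rewrite card_imset ?card_ord // => d e /sinj.
      by move=> /(_ (ltn_ord d) (ltn_ord e))/val_inj.
    have := cardsUI (tnth S (chi x)) D; rewrite cardS => + cD; rewrite cD.
    have := max_card (mem (tnth S (chi x) :|: D)); rewrite card_ord.
    case: #|_ :&: _| => // cm; rewrite addn0 => cU; move: cm.
    by rewrite cU addnS subnKC ?ltnn // ltnW.
  rewrite inE => /andP[iS /imsetP[d _ id]]; exists i; split=> //.
  by exists (val d) => //; exact: (ltn_ord d).
have a (j : 'I_m) : X j.
  by have /cid[] : exists x : X j, True by case: (hX j) => x; exists x.
apply: (@line_coloring_absurd (m - k) 'I_m X s c a) => //.
- by move=> d /sP[].
- by move=> x; case: (cP x).
(* If [c x = i], then [i] lies in the set listed at [chi x], so [x] is in the class of [b] for its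
   own color; there are only [n] colors. *)
move=> b i; apply: (@sub_finite_set (cube S X) _
  (\bigcup_(l in [set: 'I_n])
    [set x | @hclass _ (cube S X) l b x /\ chi x = l])).
  move=> x [bx cx]; exists (chi x) => //; split=> // j jS.
  apply: bx; rewrite inE; apply: contraNneq jS => ->.
  by rewrite -cx; case: (cP x).
by apply: bigcup_finite => // l _; apply: acc.
Qed.
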